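(* Let $\mathbb A\subseteq\mathbb R^{m_1\times m_2}$ be any set of matrices, let $\lambda>0$, and let $\hat A^\lambda\in\mathbb A$ be a minimizer over $A\in\mathbb A$ of $$L_n(A)=\|A\|_{L_2(\Pi)}^2-\Big\langle \tfrac2n\sum_{i=1}^n Y_iX_i,\,A\Big\rangle+\lambda\|A\|_1 .$$ Let $\mathbf M=\frac1n\sum_{i=1}^n\big(Y_iX_i-\mathbb E(Y_iX_i)\big)$. If $\lambda\ge 2\|\mathbf M\|_\infty$, then $$\|\hat A^\lambda-A_0\|_{L_2(\Pi)}^2\le\inf_{A\in\mathbb A}\Big[\|A-A_0\|_{L_2(\Pi)}^2+2\lambda\|A\|_1\Big].$$ If, in addition, $\mathbb A$ is convex and there exists a constant $\mu>0$ such that $\|A\|_{L_2(\Pi)}^2\ge\mu^{-2}\|A\|_2^2$ for all $A\in\mathbb A-\mathbb A:=\{A_1-A_2:A_1,A_2\in\mathbb A\}$, then $$\|\hat A^\lambda-A_0\|_{L_2(\Pi)}^2\le\inf_{A\in\mathbb A}\Big[\|A-A_0\|_{L_2(\Pi)}^2+\Big(\tfrac{1+\sqrt2}{2}\Big)^2\mu^2\lambda^2\,\mathrm{rank}(A)\Big].$$ Furthermore, in this case, for all $A\in\mathbb A$ with support $(S_1,S_2)$, $$\|\hat A^\lambda-A_0\|_{L_2(\Pi)}^2+(\lambda-2\|\mathbf M\|_\infty)\,\|P_{S_1^\perp}\hat A^\lambda P_{S_2^\perp}\|_1\le\|A-A_0\|_{L_2(\Pi)}^2+\Big(\tfrac{1+\sqrt2}{2}\Big)^2\mu^2\lambda^2\,\mathrm{rank}(A).$$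 (The inequalities hold for every realization of the data for which $\lambda\ge2\|\mathbf M\|_\infty$.)
   Context: Trace regression model: $(X_i,Y_i)$, $i=1,\dots,n$, are independent random pairs, $X_i$ a random matrix in $\mathbb R^{m_1\times m_2}$ and $Y_i$ a real random variable, with $\mathbb E(Y_i\mid X_i)=\mathrm{tr}(X_i^\top A_0)$ for an unknown matrix $A_0\in\mathbb R^{m_1\times m_2}$. All expectations that appear are assumed to exist and be finite. Notation: $\langle A,B\rangle=\mathrm{tr}(A^\top B)$; $\|A\|_{L_2(\Pi)}^2=\frac1n\sum_{i=1}^n\mathbb E\langle A,X_i\rangle^2$ (a squared semi-norm). $\|A\|_1$, $\|A\|_2$, $\|A\|_\infty$ denote the Schatten norms: nuclear norm (sum of singular values), Frobenius norm, and operator norm (largest singular value). If $A=\sum_{j=1}^r\sigma_ju_jv_j^\top$ is a singular value decomposition with $r=\mathrm{rank}(A)$ and $\sigma_j>0$, the support of $A$ is the pair $(S_1,S_2)$ with $S_1=\mathrm{span}\{u_1,\dots,u_r\}\subseteq\mathbb R^{m_1}$, $S_2=\mathrm{span}\{v_1,\dots,v_r\}\subseteq\mathbb R^{m_2}$. $S^\perp$ is the orthogonal complement of $S$ and $P_S$ the orthogonal projector onto $S$. *)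

(* Defs.v *)
From HB Require Import structures.
From mathcomp Require Import all_boot all_order all_algebra.
From mathcomp Require Import complex.
From mathcomp Require Import all_classical all_reals all_analysis.

Set Implicit Arguments.
Unset Strict Implicit.
Unset Printing Implicit Defensive.

Import Order.TTheory GRing.Theory Num.Theory.
Import numFieldNormedType.Exports.

Local Open Scope classical_set_scope.
Local Open Scope ring_scope.

Notation borel_mx R m n := (g_sigma_algebraType (@open 'M[R]_(m, n))).

Section Matrices.
Context {R : realType}.

Definition mxdot {m n} (A B : 'M[R]_(m, n)) : R := \tr (A^T *m B).

(* The square roots of the n eigenvalues of A^T A, with multiplicity and in no
   particular order; at least n - m of them vanish when m < n.  The library
   diagonalizes normal matrices over a closed field, whence the passage through
   R[i]. *)
Definition singular_value {m n} (A : 'M[R]_(m, n)) (j : 'I_n) : R :=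
  Num.sqrt (complex.Re
    (spectral_diag (map_mx (real_complex R) (A^T *m A)) 0 j)).

Definition nuclear_norm {m n} (A : 'M[R]_(m, n)) : R :=
  \sum_j singular_value A j.

Definition frobenius_norm {m n} (A : 'M[R]_(m, n)) : R :=
  Num.sqrt (mxdot A A).

Definition operator_norm {m n} (A : 'M[R]_(m, n)) : R :=
  \big[Num.max/0]_j singular_value A j.

(* Reduced decomposition A = \sum_j s_j u_j v_j^T: the u_j and the v_j are the
   columns of U and of V. *)
Definition is_svd {m n} (A : 'M[R]_(m, n)) (U : 'M[R]_(m, \rank A))
    (s : 'rV[R]_(\rank A)) (V : 'M[R]_(n, \rank A)) : Prop :=
  [/\ U^T *m U = 1%:M, V^T *m V = 1%:M,
      forall j, 0 < s 0 j & A = U *m diag_mx s *m V^T].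
Arguments is_svd {m n} A U s V.

(* A linear subspace of R^m is represented by a square matrix whose row space
   is that subspace. *)
Definition is_support {m n} (A : 'M[R]_(m, n)) (S1 : 'M[R]_m) (S2 : 'M[R]_n) :
    Prop :=
  exists U s V, [/\ is_svd A U s V, (S1 :=: U^T)%MS & (S2 :=: V^T)%MS].

Definition orth_compl {m} (S : 'M[R]_m) : 'M[R]_m := orthomx idfun 1%:M S.

(* proj_mx acts on row vectors; the matrix of an orthogonal projector is
   symmetric, so the same matrix projects column vectors by left product. *)
Definition orth_proj {m} (S : 'M[R]_m) : 'M[R]_m :=
  proj_mx <<S>>%MS (orth_compl S).

End Matrices.

Section Probability.
Context {d : measure_display} {T : measurableType d} {R : realType}.
Variable P : probability T R.

Definition mutually_independent {d'} {T' : measurableType d'} {I : finType}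
    (Z : I -> T -> T') : Prop :=
  forall (J : {set I}) (E : I -> set T'), (forall i, measurable (E i)) ->
    (P (\bigcap_(i in [set` J]) Z i @^-1` E i) =
     \prod_(i in J) P (Z i @^-1` E i))%E.

(* Z is a version of the conditional expectation of Y given sigma(X). *)
Definition is_cond_expectation {d'} {T' : measurableType d'}
    (Y : T -> R) (X : T -> T') (Z : T -> R) : Prop :=
  [/\ P.-integrable setT (EFin \o Y),
      P.-integrable setT (EFin \o Z),
      forall B : set R, measurable B ->
        g_sigma_algebra_preimage X (Z @^-1` B)
    & forall E : set T, g_sigma_algebra_preimage X E ->
        (\int[P]_(w in E) (Y w)%:E = \int[P]_(w in E) (Z w)%:E)%E].

Definition mx_expectation {m n} (Z : T -> 'M[R]_(m, n)) : 'M[R]_(m, n) :=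
  \matrix_(a, b) fine 'E_P[fun w => Z w a b]%E.

End Probability.

Section TraceRegression.
Context {d : measure_display} {T : measurableType d} {R : realType}.
Context {P : probability T R} {m1 m2 n : nat}.
Variables (X : 'I_n -> {RV P >-> borel_mx R m1 m2}) (Y : 'I_n -> {RV P >-> R}).

(* Square integrability is required in every direction A because the L_2(Pi)
   semi-norm is a function on the whole matrix space. *)
Record trace_regression (A0 : 'M[R]_(m1, m2)) : Prop := {
  trace_regression_indep :
    mutually_independent P (fun i w => (X i w, Y i w)) ;
  trace_regression_cond : forall i,
    is_cond_expectation P (Y i) (X i) (fun w => mxdot (X i w) A0) ;
  trace_regression_sq_integrable : forall i (A : 'M[R]_(m1, m2)),
    P.-integrable setT (fun w => ((mxdot A (X i w)) ^+ 2)%:E) ;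
  trace_regression_YX_integrable : forall i a b,
    P.-integrable setT (fun w => ((Y i w *: (X i w : 'M[R]_(m1, m2))) a b)%:E)
}.

(* The matrix A is held fixed: at an estimator, the randomness of the estimator
   is not averaged out. *)
Definition sqnorm_L2Pi (A : 'M[R]_(m1, m2)) : R :=
  n%:R^-1 * \sum_(i < n) fine 'E_P[fun w => ((mxdot A (X i w)) ^+ 2)%R]%E.

Definition objective (lambda : R) (w : T) (A : 'M[R]_(m1, m2)) : R :=
  sqnorm_L2Pi A
  - mxdot ((2 / n%:R) *: \sum_(i < n) Y i w *: (X i w : 'M[R]_(m1, m2))) A
  + lambda * nuclear_norm A.

Definition noise_mx (w : T) : 'M[R]_(m1, m2) :=
  n%:R^-1 *: \sum_(i < n)
    (Y i w *: (X i w : 'M[R]_(m1, m2))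
     - mx_expectation P (fun w' => Y i w' *: (X i w' : 'M[R]_(m1, m2)))).

Definition is_minimizer {S : Type} (f : S -> R) (D : set S) (x : S) : Prop :=
  D x /\ forall y, D y -> f x <= f y.

End TraceRegression.

(* Main.v *)
Require Import Defs.
From mathcomp Require Import all_boot all_order all_algebra.
From mathcomp Require Import complex ring lra.
From mathcomp Require Import all_classical all_reals all_analysis.
From mathcomp Require Import measurable_realfun.

(* By the law of iterated expectations, up to a constant the objective at A is
   |A - A0|^2 - 2 <M, A> + lambda |A|_1 with |.| the L_2(Pi) semi-norm.  Trace duality
   <M, A> <= |M|_oo |A|_1 gives the first inequality.  For convex sets, moving from the
   minimizer B towards A and letting the step tend to 0 yields
     |B - A0|^2 + |B - A|^2 <= |A - A0|^2 + 2 <M, B - A> + lambda (|A|_1 - |B|_1).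
   With P1, P2 the orthogonal projectors onto the column and row spaces of A, P' = 1 - P,
   and contractions W, W' such that <W, A> = |A|_1 and <W', P1' B P2'> = |P1' B P2'|_1,
   the contraction P1 W P2 + P1' W' P2' is a subgradient at A, so that
     |B|_1 - |A|_1 >= <P1 W P2, B - A> + |P1' B P2'|_1.
   As <P1' M P2', B - A> <= |M|_oo |P1' B P2'|_1 and M - P1' M P2' has squared Frobenius
   norm at most 2 rank(A) |M|_oo^2, Cauchy-Schwarz and 2xy <= x^2 + y^2 conclude. *)

Set Implicit Arguments.
Unset Strict Implicit.
Unset Printing Implicit Defensive.

Import Order.TTheory GRing.Theory Num.Theory.
Import numFieldNormedType.Exports.

Local Open Scope classical_set_scope.
Local Open Scope ring_scope.

(** * The Frobenius inner product *)

Section FrobeniusProduct.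
Context {R : realType}.

Lemma mxdotE m n (A B : 'M[R]_(m, n)) : mxdot A B = \sum_i \sum_j A i j * B i j.
Proof.
rewrite /mxdot /mxtrace exchange_big /=; apply: eq_bigr => j _.
by rewrite mxE; apply: eq_bigr => i _; rewrite mxE.
Qed.

Lemma mxdotC m n (A B : 'M[R]_(m, n)) : mxdot A B = mxdot B A.
Proof. by rewrite /mxdot -mxtrace_tr trmx_mul trmxK. Qed.

Lemma mxdotDr m n (A B C : 'M[R]_(m, n)) : mxdot A (B + C) = mxdot A B + mxdot A C.
Proof. by rewrite /mxdot mulmxDr mxtraceD. Qed.

Lemma mxdotZr m n a (A B : 'M[R]_(m, n)) : mxdot A (a *: B) = a * mxdot A B.
Proof. by rewrite /mxdot -scalemxAr mxtraceZ. Qed.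

Lemma mxdotNr m n (A B : 'M[R]_(m, n)) : mxdot A (- B) = - mxdot A B.
Proof. by rewrite -scaleN1r mxdotZr mulN1r. Qed.

Lemma mxdotBr m n (A B C : 'M[R]_(m, n)) : mxdot A (B - C) = mxdot A B - mxdot A C.
Proof. by rewrite mxdotDr mxdotNr. Qed.

Lemma mxdotDl m n (A B C : 'M[R]_(m, n)) : mxdot (A + B) C = mxdot A C + mxdot B C.
Proof. by rewrite mxdotC mxdotDr !(mxdotC C). Qed.

Lemma mxdotZl m n a (A B : 'M[R]_(m, n)) : mxdot (a *: A) B = a * mxdot A B.
Proof. by rewrite mxdotC mxdotZr mxdotC. Qed.

Lemma mxdotNl m n (A B : 'M[R]_(m, n)) : mxdot (- A) B = - mxdot A B.
Proof. by rewrite mxdotC mxdotNr mxdotC. Qed.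

Lemma mxdotBl m n (A B C : 'M[R]_(m, n)) : mxdot (A - B) C = mxdot A C - mxdot B C.
Proof. by rewrite mxdotDl mxdotNl. Qed.

Lemma mxdot_suml m n (I : finType) (F : I -> 'M[R]_(m, n)) B :
  mxdot (\sum_i F i) B = \sum_i mxdot (F i) B.
Proof.
apply: (big_morph (fun A => mxdot A B)); first by move=> *; rewrite mxdotDl.
by rewrite -(scale0r B) mxdotZl mul0r.
Qed.

Lemma mxdot_ge0 m n (A : 'M[R]_(m, n)) : 0 <= mxdot A A.
Proof. by rewrite mxdotE !sumr_ge0// => i _; rewrite sumr_ge0// => j _; rewrite -expr2 sqr_ge0. Qed.

Lemma mxdot_delta m n (a : 'I_m) (b : 'I_n) (A : 'M[R]_(m, n)) :
  mxdot (delta_mx a b) A = A a b.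
Proof.
rewrite mxdotE (bigD1 a)//= (bigD1 b)//= mxE !eqxx mul1r.
rewrite big1 => [|c cb]; last by rewrite mxE (negbTE cb) andbF mul0r.
rewrite addr0 big1 ?addr0// => c ca; rewrite big1// => e _.
by rewrite mxE (negbTE ca) mul0r.
Qed.

Lemma mxdot_eq0 m n (A : 'M[R]_(m, n)) : mxdot A A = 0 -> A = 0.
Proof.
move=> A0; apply/matrixP => i j; rewrite mxE; move/eqP: A0; rewrite mxdotE.
rewrite psumr_eq0; last first.
  by move=> k _; rewrite sumr_ge0// => l _; rewrite -expr2 sqr_ge0.
move=> /allP /(_ i); rewrite mem_index_enum => /(_ isT); rewrite psumr_eq0; last first.
  by move=> k _; rewrite -expr2 sqr_ge0.
move=> /allP /(_ j); rewrite mem_index_enum => /(_ isT).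
by rewrite mulf_eq0 orbb => /eqP.
Qed.

Lemma mxdot_mull m n p (X : 'M[R]_(m, p)) (A : 'M[R]_(p, n)) B :
  mxdot (X *m A) B = mxdot A (X^T *m B).
Proof. by rewrite /mxdot trmx_mul mulmxA. Qed.

Lemma mxdot_mulr m n p (X : 'M[R]_(p, n)) (A : 'M[R]_(m, p)) B :
  mxdot (A *m X) B = mxdot A (B *m X^T).
Proof. by rewrite /mxdot trmx_mul -mulmxA mxtrace_mulC mulmxA. Qed.

Lemma mxdot_tr m n (A B : 'M[R]_(m, n)) : mxdot A^T B^T = mxdot A B.
Proof. by rewrite /mxdot trmxK mxtrace_mulC -mxtrace_tr trmx_mul trmxK. Qed.

Lemma mxdot_rows m n (A B : 'M[R]_(m, n)) :
  mxdot A B = \sum_k mxdot (row k A) (row k B).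
Proof.
rewrite mxdotE; apply: eq_bigr => k _; rewrite mxdotE big_ord1.
by apply: eq_bigr => j _; rewrite !mxE.
Qed.

Lemma row_diag_mulmx m n (d : 'rV[R]_m) (A : 'M[R]_(m, n)) k :
  row k (diag_mx d *m A) = d 0 k *: row k A.
Proof. by apply/rowP => j; rewrite mul_diag_mx !mxE. Qed.

Lemma mxdot_diag m n (d : 'rV[R]_m) (A B : 'M[R]_(m, n)) :
  mxdot (diag_mx d *m A) B = \sum_k d 0 k * mxdot (row k A) (row k B).
Proof.
rewrite mxdot_rows; apply: eq_bigr => k _.
by rewrite row_diag_mulmx mxdotZl.
Qed.

Lemma mxdot_CauchySchwarz m n (A B : 'M[R]_(m, n)) :
  mxdot A B ^+ 2 <= mxdot A A * mxdot B B.
Proof.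
have [B0|B0] := eqVneq (mxdot B B) 0; last first.
  have Bgt0 : 0 < mxdot B B by rewrite lt_neqAle eq_sym B0 mxdot_ge0.
  (* The squared norm of this combination is [mxdot B B] times the gap in the claim. *)
  have := mxdot_ge0 (mxdot B B *: A - mxdot A B *: B).
  rewrite mxdotBr !mxdotBl !mxdotZl !mxdotZr (mxdotC B A) => h.
  rewrite -subr_ge0 -(pmulr_rge0 _ Bgt0); apply: le_trans h _.
  by rewrite le_eqVlt; apply/orP; left; apply/eqP; ring.
suff -> : mxdot A B = 0 by rewrite expr0n/= mulr_ge0 ?mxdot_ge0.
by rewrite (mxdot_eq0 B0) -(scale0r A) mxdotZr mul0r.
Qed.

Lemma mxdot_le m n (A B : 'M[R]_(m, n)) (a b : R) : 0 <= a -> 0 <= b ->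
  mxdot A A <= a ^+ 2 -> mxdot B B <= b ^+ 2 -> mxdot A B <= a * b.
Proof.
move=> a0 b0 Aa Bb; apply: (le_trans (ler_norm _)).
rewrite -(@ler_pXn2r _ 2) ?nnegrE ?mulr_ge0//.
rewrite real_normK ?num_real// (le_trans (mxdot_CauchySchwarz _ _))//.
by rewrite exprMn ler_pM ?mxdot_ge0.
Qed.

End FrobeniusProduct.

(** * Singular values and trace duality *)

Section RealParts.
Local Open Scope sesquilinear_scope.
Context {R : realType}.
Local Notation Remx := (map_mx (@complex.Re R)).
Local Notation Immx := (map_mx (@complex.Im R)).

Lemma Re_sum n (F : 'I_n -> R[i]%C) :
  complex.Re (\sum_i F i) = \sum_i complex.Re (F i).
Proof. by apply: (big_morph (@complex.Re R)) => // -[? ?] [? ?]. Qed.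

Lemma Im_sum n (F : 'I_n -> R[i]%C) :
  complex.Im (\sum_i F i) = \sum_i complex.Im (F i).
Proof. by apply: (big_morph (@complex.Im R)) => // -[? ?] [? ?]. Qed.

Lemma Remx_mul m n p (A : 'M[R[i]%C]_(m, n)) (B : 'M[R[i]%C]_(n, p)) :
  Remx (A *m B) = Remx A *m Remx B - Immx A *m Immx B.
Proof.
apply/matrixP => i j; rewrite !mxE Re_sum -sumrB; apply: eq_bigr => k _.
by rewrite !mxE; case: (A i k) => ? ?; case: (B k j).
Qed.

Lemma Immx_mul m n p (A : 'M[R[i]%C]_(m, n)) (B : 'M[R[i]%C]_(n, p)) :
  Immx (A *m B) = Remx A *m Immx B + Immx A *m Remx B.
Proof.
apply/matrixP => i j; rewrite !mxE Im_sum -big_split; apply: eq_bigr => k _.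
by rewrite !mxE; case: (A i k) => ? ?; case: (B k j).
Qed.

Lemma Remx_adj m n (A : 'M[R[i]%C]_(m, n)) : Remx (A^t*) = (Remx A)^T.
Proof. by apply/matrixP => i j; rewrite !mxE; case: (A j i). Qed.

Lemma Immx_adj m n (A : 'M[R[i]%C]_(m, n)) : Immx (A^t*) = - (Immx A)^T.
Proof. by apply/matrixP => i j; rewrite !mxE; case: (A j i). Qed.

Lemma Remx1 n : Remx (1%:M : 'M[R[i]%C]_n) = 1%:M.
Proof. by apply/matrixP => i j; rewrite !mxE; case: (i == j). Qed.

Lemma Immx1 n : Immx (1%:M : 'M[R[i]%C]_n) = 0.
Proof. by apply/matrixP => i j; rewrite !mxE; case: (i == j). Qed.

Lemma Remx_real m n (A : 'M[R]_(m, n)) : Remx (map_mx (real_complex R) A) = A.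
Proof. by apply/matrixP => i j; rewrite !mxE. Qed.

Lemma Immx_real m n (A : 'M[R]_(m, n)) : Immx (map_mx (real_complex R) A) = 0.
Proof. by apply/matrixP => i j; rewrite !mxE. Qed.

Lemma Remx_diag n (d : 'rV[R[i]%C]_n) : Remx (diag_mx d) = diag_mx (Remx d).
Proof. by apply/matrixP => i j; rewrite !mxE; case: (i == j). Qed.

Lemma Immx_diag n (d : 'rV[R[i]%C]_n) : Immx (diag_mx d) = diag_mx (Immx d).
Proof. by apply/matrixP => i j; rewrite !mxE; case: (i == j). Qed.

Definition gram_spectrum m n (A : 'M[R]_(m, n)) : 'rV[R]_n :=
  Remx (spectral_diag (map_mx (real_complex R) (A^T *m A))).

(* X and Y are the real and imaginary parts of a unitary matrix that diagonalizes
   A^T A: their 2n rows form a Parseval frame of real eigenvectors. *)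
Lemma gram_eigenframe m n (A : 'M[R]_(m, n)) : exists X Y : 'M[R]_n,
  [/\ X^T *m X + Y^T *m Y = 1%:M,
      X *m X^T + Y *m Y^T = 1%:M, Y *m X^T = X *m Y^T,
      X *m (A^T *m A) = diag_mx (gram_spectrum A) *m X
    & Y *m (A^T *m A) = diag_mx (gram_spectrum A) *m Y].
Proof.
set H := A^T *m A; pose HC := map_mx (real_complex R) H.
have Hherm : HC \is hermsymmx.
  apply/is_hermitianmxP; rewrite expr0 scale1r; apply/matrixP => i j.
  rewrite !mxE; have -> : (\sum_k A^T i k * A k j) = (\sum_k A^T j k * A k i).
    by apply: eq_bigr => k _; rewrite !mxE mulrC.
  by rewrite [RHS]conjc_real.
(* Eigenvalues of a Hermitian matrix are real, so [Q *m HC = D *m Q] splits into one real equation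
   for each part of [Q]. *)
have dreal : diag_mx (Immx (spectral_diag HC)) = 0.
  suff -> : Immx (spectral_diag HC) = 0 by apply/matrixP => i j; rewrite !mxE mul0rn.
  apply/matrixP => i j; rewrite !mxE.
  have /mxOverP /(_ i j) := hermitian_spectral_diag_real Hherm.
  by move/RIm_real => /(congr1 (@complex.Re R)).
have /hermitian_normalmx /orthomx_spectralP := Hherm.
set Q := spectralmx HC; set D := diag_mx _ => HCE.
have Qu : Q \is unitarymx by exact: spectral_unitarymx.
have QQ : Q *m Q^t* = 1%:M by exact/unitarymxP.
have QQ' : Q^t* *m Q = 1%:M by rewrite -invmx_unitary// mulVmx// unitarymx_unit.
have QH : Q *m HC = D *m Q.
  by rewrite HCE invmx_unitary// !mulmxA QQ mul1mx.
exists (Remx Q), (Immx Q).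
(* The first two identities are real parts, and the third an imaginary part, of the unitarity
   relations; the last two come from [QH]. *)
have := congr1 Remx QQ'; rewrite Remx_mul Remx_adj Immx_adj mulNmx opprK Remx1 => ->.
have := congr1 Remx QQ; rewrite Remx_mul Remx_adj Immx_adj mulmxN opprK Remx1 => ->.
have := congr1 Immx QQ; rewrite Immx_mul Remx_adj Immx_adj mulmxN Immx1 addrC => /eqP.
rewrite subr_eq0 => /eqP ->.
have := congr1 Remx QH; rewrite !Remx_mul Remx_diag Immx_diag dreal Remx_real Immx_real.
rewrite mulmx0 mul0mx !subr0 => ->.
have := congr1 Immx QH; rewrite !Immx_mul Remx_diag Immx_diag dreal Remx_real Immx_real.
by rewrite mulmx0 mul0mx !add0r addr0 => ->.
Qed.

End RealParts.

Section TraceDuality.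
Context {R : realType}.

(** For [c >= 0] this bounds the operator norm by [c]. Letting [Z] have any number of columns makes
    it apply directly to vectors and to projectors. *)
Definition opbound m n (c : R) (B : 'M[R]_(m, n)) : Prop :=
  forall p (Z : 'M[R]_(n, p)), mxdot (B *m Z) (B *m Z) <= c ^+ 2 * mxdot Z Z.

Lemma mxdot_gram_eigenrow m n (A : 'M[R]_(m, n)) (X : 'M[R]_n) k :
  X *m (A^T *m A) = diag_mx (gram_spectrum A) *m X ->
  mxdot (row k (X *m A^T)) (row k (X *m A^T))
  = gram_spectrum A 0 k * mxdot (row k X) (row k X).
Proof.
move=> XH; rewrite {1}row_mul mxdot_mulr trmxK -row_mul -mulmxA XH.
by rewrite row_diag_mulmx mxdotZr.
Qed.

Lemma mxdot_row_frame m n (X Y : 'M[R]_(m, n)) k :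
  X *m X^T + Y *m Y^T = 1%:M ->
  mxdot (row k X) (row k X) + mxdot (row k Y) (row k Y) = 1.
Proof.
move=> /matrixP /(_ k k); rewrite !mxE eqxx -[true%:R]/(1 : R) => <-.
by congr (_ + _); rewrite mxdotE big_ord1; apply: eq_bigr => j _; rewrite !mxE.
Qed.

(** The k-th rows of [X] and [Y] have squared norms summing to 1, so the eigenvalue is the sum of
    the squared norms of their images under [A]. *)
Lemma gram_spectrum_ge0 m n (A : 'M[R]_(m, n)) k : 0 <= gram_spectrum A 0 k.
Proof.
have [X [Y [_ XX _ XH YH]]] := gram_eigenframe A.
rewrite -[gram_spectrum A 0 k]mulr1 -(mxdot_row_frame k XX) mulrDr.
by rewrite -!mxdot_gram_eigenrow// addr_ge0 ?mxdot_ge0.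
Qed.

Lemma singular_valueE m n (A : 'M[R]_(m, n)) k :
  singular_value A k = Num.sqrt (gram_spectrum A 0 k).
Proof. by rewrite /singular_value mxE. Qed.

Lemma sqr_singular_value m n (A : 'M[R]_(m, n)) k :
  singular_value A k ^+ 2 = gram_spectrum A 0 k.
Proof. by rewrite singular_valueE sqr_sqrtr ?gram_spectrum_ge0. Qed.

Lemma singular_value_ge0 m n (A : 'M[R]_(m, n)) k : 0 <= singular_value A k.
Proof. exact: sqrtr_ge0. Qed.

Lemma nuclear_norm_ge0 m n (A : 'M[R]_(m, n)) : 0 <= nuclear_norm A.
Proof. by apply: sumr_ge0 => k _; exact: singular_value_ge0. Qed.

Lemma operator_norm_ge0 m n (A : 'M[R]_(m, n)) : 0 <= operator_norm A.
Proof. exact: bigmax_ge_id. Qed.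

(** Parseval's identity for the frame made of the rows of [X] and [Y]. *)
Lemma mxdot_frame m n k (X Y : 'M[R]_(k, n)) (A B : 'M[R]_(m, n)) :
  X^T *m X + Y^T *m Y = 1%:M ->
  mxdot A B = mxdot (X *m A^T) (X *m B^T) + mxdot (Y *m A^T) (Y *m B^T).
Proof.
move=> XX; rewrite !(mxdot_mull _ _ (_ *m B^T)) -mxdotDr !mulmxA -mulmxDl XX.
by rewrite mul1mx mxdot_tr.
Qed.

(** In the eigenframe, the squared norm of [A *m Z] weights the squared coefficients of [Z] by
    squared singular values, each at most the largest one. *)
Lemma opbound_operator_norm m n (A : 'M[R]_(m, n)) : opbound (operator_norm A) A.
Proof.
move=> p Z; have [X [Y [XX _ _ XH YH]]] := gram_eigenframe A.
rewrite mxdot_mull mulmxA mxdotC -mxdot_tr (mxdot_frame _ _ XX) !trmxK.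
rewrite ![_ *m (A^T *m A *m Z)]mulmxA XH YH -!(mulmxA (diag_mx _)).
rewrite !mxdot_diag.
rewrite -(mxdot_tr Z) (mxdot_frame Z^T _ XX) !trmxK mulrDr.
rewrite !(mxdot_rows (_ *m Z)) !mulr_sumr; apply: lerD; apply: ler_sum => k _;
  rewrite ler_wpM2r ?mxdot_ge0// -sqr_singular_value;
  rewrite ler_pXn2r ?nnegrE ?operator_norm_ge0 ?singular_value_ge0//;
  exact: le_bigmax.
Qed.

(** Expand in the eigenframe of [A]: by Cauchy-Schwarz the k-th pair of frame vectors contributes at
    most [c * singular_value A k] times its total squared norm, which is 1. *)
Lemma trace_duality m n (A B : 'M[R]_(m, n)) c : 0 <= c -> opbound c B ->
  mxdot B A <= c * nuclear_norm A.
Proof.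
move=> c0 Bc; have [X [Y [XX XX' _ XH YH]]] := gram_eigenframe A.
rewrite (mxdot_frame _ _ XX) !(mxdot_rows (_ *m B^T)) -big_split /=.
rewrite /nuclear_norm mulr_sumr; apply: ler_sum => k _.
have bound Z : Z *m (A^T *m A) = diag_mx (gram_spectrum A) *m Z ->
    mxdot (row k (Z *m B^T)) (row k (Z *m A^T)) <=
    c * singular_value A k * mxdot (row k Z) (row k Z).
  move=> ZH; have -> : c * singular_value A k * mxdot (row k Z) (row k Z)
      = (c * frobenius_norm (row k Z))
        * (singular_value A k * frobenius_norm (row k Z)).
    by rewrite -[mxdot _ _]sqr_sqrtr ?mxdot_ge0// -/(frobenius_norm _); ring.
  apply: mxdot_le; rewrite ?mulr_ge0 ?sqrtr_ge0//.
    rewrite exprMn sqr_sqrtr ?mxdot_ge0// -mxdot_tr row_mul trmx_mul trmxK.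
    by rewrite (le_trans (Bc _ _))// mxdot_tr.
  by rewrite exprMn sqr_singular_value sqr_sqrtr ?mxdot_ge0// mxdot_gram_eigenrow.
rewrite (le_trans (lerD (bound X XH) (bound Y YH)))// -mulrDr.
by rewrite (mxdot_row_frame k XX') mulr1.
Qed.

(** Trace duality is sharp, so the nuclear norm is a maximum of linear functionals over
    contractions; convexity and subgradients rest on this. *)
Lemma nuclear_norm_attained m n (A : 'M[R]_(m, n)) :
  exists2 W : 'M[R]_(m, n), opbound 1 W & mxdot W A = nuclear_norm A.
Proof.
have [X [Y [XX XX' YX XH YH]]] := gram_eigenframe A.
pose D := diag_mx (gram_spectrum A).
pose S := diag_mx (\row_k (singular_value A k)^-1).
(* The polar factor of A; S relies on 0^-1 = 0. *)
exists (A *m (X^T *m S *m X + Y^T *m S *m Y)).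
  move=> p Z; rewrite expr1n mul1r.
  pose u := S *m (X *m Z); pose v := S *m (Y *m Z).
  have -> : A *m (X^T *m S *m X + Y^T *m S *m Y) *m Z
      = A *m (X^T *m u + Y^T *m v).
    by rewrite /u /v -!mulmxA; congr (_ *m _); rewrite mulmxDl -!mulmxA.
  have gram (U V : 'M[R]_n) (x y : 'M[R]_(n, p)) :
      U *m (A^T *m A) = D *m U ->
      mxdot (A *m (U^T *m x)) (A *m (V^T *m y)) = mxdot x (D *m (U *m V^T *m y)).
    move=> UH; rewrite mxdot_mull mxdot_mull trmxK; congr mxdot.
    by rewrite !mulmxA -UH -!mulmxA.
  (* [Y^T u - X^T v] is minus the imaginary part of the complex product whose real
     part is [X^T u + Y^T v]. *)
  have : mxdot (A *m (X^T *m u + Y^T *m v)) (A *m (X^T *m u + Y^T *m v))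
       + mxdot (A *m (Y^T *m u - X^T *m v)) (A *m (Y^T *m u - X^T *m v))
       = mxdot (D *m u) u + mxdot (D *m v) v.
    rewrite !(mulmxBr A) !(mulmxDr A) !(mxdotDr, mxdotDl, mxdotBr, mxdotBl).
    rewrite !mxdotNr !mxdotNl.
    rewrite !gram// YX !(mxdotC (D *m _)).
    have mulXX (x : 'M[R]_(n, p)) : D *m x = D *m (X *m X^T *m x) + D *m (Y *m Y^T *m x).
      by rewrite -mulmxDr -mulmxDl XX' mul1mx.
    by rewrite (mulXX u) (mulXX v) !mxdotDr; ring.
  (* The squared singular value cancels the two inverses in [S], and it vanishes where they take the
     default value. *)
  have small (U : 'M[R]_n) : mxdot (D *m (S *m (U *m Z))) (S *m (U *m Z))
      <= mxdot (U *m Z) (U *m Z).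
    rewrite mxdot_diag (mxdot_rows (U *m Z)); apply: ler_sum => k _.
    rewrite -sqr_singular_value !row_diag_mulmx mxE mxdotZl mxdotZr.
    have [->|s0] := eqVneq (singular_value A k) 0.
      by rewrite expr0n/= mul0r mxdot_ge0.
    by rewrite le_eqVlt; apply/orP; left; apply/eqP; field.
  move=> normE; apply: (@le_trans _ _ (mxdot (D *m u) u + mxdot (D *m v) v)).
    by rewrite -normE lerDl mxdot_ge0.
  rewrite -(mxdot_tr Z) (mxdot_frame Z^T _ XX) !trmxK.
  by rewrite lerD// small.
have value (U : 'M[R]_n) : U *m (A^T *m A) = D *m U ->
    mxdot (A *m (U^T *m S *m U)) A
    = \sum_k singular_value A k * mxdot (row k U) (row k U).
  move=> UH; rewrite mxdot_mull -!mulmxA mxdot_mull trmxK UH.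
  rewrite mxdotC mxdot_diag; apply: eq_bigr => k _.
  rewrite -sqr_singular_value row_diag_mulmx mxE mxdotZr.
  have [->|s0] := eqVneq (singular_value A k) 0; first by rewrite expr0n/= !mul0r.
  by field.
rewrite mulmxDr mxdotDl !value// -big_split; apply: eq_bigr => k _ /=.
by rewrite -mulrDr (mxdot_row_frame k XX') mulr1.
Qed.

Lemma nuclear_norm_conv m n t (A B : 'M[R]_(m, n)) : 0 <= t <= 1 ->
  nuclear_norm (t *: A + (1 - t) *: B)
  <= t * nuclear_norm A + (1 - t) * nuclear_norm B.
Proof.
move=> /andP[t0 t1]; have [W Wc <-] := nuclear_norm_attained (t *: A + (1 - t) *: B).
rewrite mxdotDr !mxdotZr; have t1' : 0 <= 1 - t by rewrite subr_ge0.
by rewrite lerD// ler_wpM2l// -[nuclear_norm _]mul1r trace_duality.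
Qed.

End TraceDuality.

(** * Orthogonal projectors *)

Section OrthogonalProjectors.
Context {R : realType}.

Definition orth_projector m (P : 'M[R]_m) : Prop := P^T = P /\ P *m P = P.

Lemma orth_projectorC m (P : 'M[R]_m) : orth_projector P -> orth_projector (1%:M - P).
Proof.
move=> [Pt PP]; split; first by rewrite linearB /= trmx1 Pt.
by rewrite mulmxBl mul1mx mulmxBr mulmx1 PP subrr subr0.
Qed.

Lemma orth_complE m (S : 'M[R]_m) : orth_compl S = kermx S^T.
Proof.
rewrite /orth_compl /orthomx mul1mx; congr kermx.
by apply/matrixP => i j; rewrite !mxE.
Qed.

Lemma orth_compl_direct m (S : 'M[R]_m) : (<<S>> :&: orth_compl S)%MS = 0.
Proof.
apply/eqP; rewrite -submx0; apply/row_subP => i.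
set v := row i _.
have : (v <= <<S>> :&: orth_compl S)%MS by exact: row_sub.
rewrite sub_capmx genmxE orth_complE => /andP[/submxP[y vE] /sub_kermxP vS].
suff -> : v = 0 by exact: sub0mx.
by by apply: mxdot_eq0; rewrite {1}vE mxdot_mulr vS /mxdot mulmx0 mxtrace0.
Qed.

Lemma orth_compl_full m (S : 'M[R]_m) : (1%:M <= <<S>> + orth_compl S)%MS.
Proof.
rewrite sub1mx /row_full mxrank_disjoint_sum ?orth_compl_direct//.
rewrite mxrank_gen orth_complE mxrank_ker mxrank_tr subnKC//.
exact: rank_leq_row.
Qed.

Lemma orth_proj_sub m (S : 'M[R]_m) : (orth_proj S <= S)%MS.
Proof. by rewrite -[orth_proj S]mul1mx (submx_trans (proj_mx_sub _ _ _))// genmxE. Qed.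

Lemma orth_proj_id m p (S : 'M[R]_m) (A : 'M[R]_(p, m)) :
  (A <= S)%MS -> A *m orth_proj S = A.
Proof.
by move=> AS; apply: proj_mx_id; rewrite ?orth_compl_direct// genmxE.
Qed.

Lemma orth_proj_compl_sub m (S : 'M[R]_m) :
  (1%:M - orth_proj S <= orth_compl S)%MS.
Proof.
have := @proj_mx_compl_sub _ _ _ <<S>>%MS (orth_compl S) 1%:M (orth_compl_full S).
by rewrite mul1mx.
Qed.

Lemma orth_projP m (S : 'M[R]_m) : orth_projector (orth_proj S).
Proof.
set E := orth_proj S.
have EE : E *m E = E by apply: orth_proj_id; exact: orth_proj_sub.
have : (1%:M - E) *m E^T = 0.
  have /submxP[y Ey] : (E <= S)%MS := orth_proj_sub S; rewrite {2}Ey trmx_mul mulmxA.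
  have := orth_proj_compl_sub S; rewrite orth_complE => /sub_kermxP ->.
  by rewrite mul0mx.
(* Hence [E^T = E *m E^T], whose right side is symmetric. *)
rewrite mulmxBl mul1mx => /eqP; rewrite subr_eq0 => /eqP Et.
split=> //; rewrite [LHS]Et; apply: trmx_inj.
by rewrite trmx_mul trmxK -Et.
Qed.

(** The projectors [E] and [F] annihilate each other, while [F] fixes the rows of [1%:M - E];
    expanding the latter fact gives [F]. *)
Lemma orth_proj_orth_compl m (S : 'M[R]_m) :
  orth_proj (orth_compl S) = 1%:M - orth_proj S.
Proof.
set E := orth_proj S; set F := orth_proj (orth_compl S).
have [Et _] := orth_projP S; have [Ft _] := orth_projP (orth_compl S).
have FE : F *m E = 0.
  have /submxP[y Ey] : (E <= S)%MS := orth_proj_sub S.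
  rewrite -[E]Et -/E Ey trmx_mul mulmxA.
  have := orth_proj_sub (orth_compl S); rewrite {2}orth_complE => /sub_kermxP ->.
  by rewrite mul0mx.
have := orth_proj_id (orth_proj_compl_sub S); rewrite -/E -/F mulmxBl mul1mx.
have -> : E *m F = 0 by rewrite -[E]Et -[F]Ft -trmx_mul FE trmx0.
by rewrite subr0.
Qed.

Lemma mxdot_orth_proj m (S : 'M[R]_m) : mxdot (orth_proj S) (orth_proj S) = (\rank S)%:R.
Proof.
have [Et EE] := orth_projP S; rewrite /mxdot Et EE.
have -> : \rank S = \rank (orth_proj S).
  apply/eqP; rewrite eqn_leq !mxrankS ?orth_proj_sub//.
  by rewrite -{1}(orth_proj_id (submx_refl S)) submxMl.
move: (orth_proj S) EE => E EE.
have bE : col_base E *m row_base E = E by rewrite mulmx_base.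
rewrite -{1}bE mxtrace_mulC.
(* The trace of an idempotent is its rank: cancelling the full-rank factors in [E *m E = E] leaves
   an identity matrix of size the rank. *)
suff -> : row_base E *m col_base E = 1%:M by rewrite mxtrace1.
apply: (row_full_inj (col_base_full E)).
apply: (row_free_inj (row_base_free E)).
by rewrite mulmx1 mulmxA bE -mulmxA bE EE.
Qed.

End OrthogonalProjectors.

(** * Subgradients, noise bound and the deterministic oracle inequality *)

Section OracleInequality.
Context {R : realType}.

Lemma mxdot_projectorD m n (P : 'M[R]_m) (Z : 'M[R]_(m, n)) : orth_projector P ->
  mxdot Z Z = mxdot (P *m Z) (P *m Z)
              + mxdot ((1%:M - P) *m Z) ((1%:M - P) *m Z).
Proof.
move=> Pproj; have [Ct CC] := orth_projectorC Pproj; have [Pt PP] := Pproj.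
rewrite !(mxdot_mull _ Z) Pt Ct !mulmxA PP CC -mxdotDr -mulmxDl.
by rewrite addrC subrK mul1mx.
Qed.

Lemma mxdot_projector_le m n (P : 'M[R]_m) (Z : 'M[R]_(m, n)) : orth_projector P ->
  mxdot (P *m Z) (P *m Z) <= mxdot Z Z.
Proof. by move=> /(mxdot_projectorD Z) ->; rewrite lerDl mxdot_ge0. Qed.

(** With [t] the squared norm of [M^T *m Z], which equals the inner product of [Z] and
    [M *m M^T *m Z], Cauchy-Schwarz bounds [t ^+ 2] by a multiple of [t], and one factor [t]
    cancels. *)
Lemma opbound_tr m n c (M : 'M[R]_(m, n)) : opbound c M -> opbound c M^T.
Proof.
move=> Mc p Z; set t := mxdot _ _.
have t0 : 0 <= t by exact: mxdot_ge0.
have : t ^+ 2 <= mxdot Z Z * (c ^+ 2 * t).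
  have -> : t = mxdot Z (M *m (M^T *m Z)) by rewrite /t mxdot_mull trmxK.
  apply: le_trans (mxdot_CauchySchwarz _ _) _.
  by rewrite ler_wpM2l ?mxdot_ge0// (le_trans (Mc _ _))// mxdot_mull trmxK.
have [->|t_neq0] := eqVneq t 0; first by rewrite mulr_ge0 ?sqr_ge0 ?mxdot_ge0.
have t_gt0 : 0 < t by rewrite lt_neqAle eq_sym t_neq0.
by rewrite expr2 mulrCA mulrCA mulrA ler_pM2r// mulrC.
Qed.

(** The Frobenius bound on [U] by [P2] is what later turns the subgradient term into a rank term. *)
Lemma nuclear_norm_subgradient m n (A B : 'M[R]_(m, n)) P1 P2 :
  orth_projector P1 -> orth_projector P2 -> P1 *m A *m P2 = A ->
  exists2 U : 'M[R]_(m, n), mxdot U U <= mxdot P2 P2 &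
    nuclear_norm A + mxdot U (B - A)
    + nuclear_norm ((1%:M - P1) *m B *m (1%:M - P2)) <= nuclear_norm B.
Proof.
move=> P1p P2p PAP; set K := _ *m B *m _.
have [W Wc WA] := nuclear_norm_attained A.
have [V Vc VK] := nuclear_norm_attained K.
have C1p := orth_projectorC P1p; have C2p := orth_projectorC P2p.
have [[P1t P11] [P2t P22]] := (P1p, P2p).
have [[C1t C11] [C2t C22]] := (C1p, C2p).
pose U := P1 *m W *m P2; pose U' := (1%:M - P1) *m V *m (1%:M - P2).
have PC : P1 *m (1%:M - P1) = 0 by rewrite mulmxBr mulmx1 P11 subrr.
have CP : (1%:M - P1) *m P1 = 0 by rewrite mulmxBl mul1mx P11 subrr.
exists U.
  rewrite /U -mulmxA (le_trans (mxdot_projector_le _ P1p))//.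
  by rewrite (le_trans (Wc _ _))// expr1n mul1r.
(* The two summands have orthogonal ranges and act on orthogonal components of [Z], so Pythagoras
   keeps their sum a contraction. *)
have UU' : opbound 1 (U + U').
  move=> p Z; rewrite expr1n mul1r.
  rewrite (mxdot_projectorD _ P1p) mulmxA [in X in _ + X]mulmxA.
  have -> : P1 *m (U + U') = U.
    by rewrite mulmxDr /U /U' !mulmxA P11 PC !mul0mx addr0.
  have -> : (1%:M - P1) *m (U + U') = U'.
    by rewrite mulmxDr /U /U' !mulmxA C11 CP !mul0mx add0r.
  rewrite (mxdot_projectorD Z P2p) lerD// -!mulmxA.
    rewrite (le_trans (mxdot_projector_le _ P1p))// (le_trans (Wc _ _))//.
    by rewrite expr1n mul1r.
  rewrite (le_trans (mxdot_projector_le _ C1p))// (le_trans (Vc _ _))//.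
  by rewrite expr1n mul1r.
have := trace_duality B ler01 UU'; rewrite mul1r; apply: le_trans.
rewrite -WA -VK mxdotBr mxdotDl.
have -> : mxdot U' B = mxdot V K by rewrite mxdot_mulr mxdot_mull C1t C2t mulmxA.
have -> : mxdot U A = mxdot W A by rewrite mxdot_mulr mxdot_mull P1t P2t mulmxA PAP.
by lra.
Qed.

(** The block [N3] does not see [A], so duality applies to [B] alone. The blocks [N1] and [N2] are
    orthogonal, each of squared Frobenius norm at most [c ^+ 2 * r], whence the factor
    [Num.sqrt 2]. *)
Lemma mxdot_noise_le m n c (M A B : 'M[R]_(m, n)) P1 P2 (r : R) : 0 <= c -> 0 <= r ->
  opbound c M -> orth_projector P1 -> orth_projector P2 -> P1 *m A *m P2 = A ->
  mxdot P1 P1 <= r -> mxdot P2 P2 <= r ->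
  mxdot M (B - A) <= c * nuclear_norm ((1%:M - P1) *m B *m (1%:M - P2))
    + Num.sqrt 2 * c * Num.sqrt r * frobenius_norm (B - A).
Proof.
move=> c0 r0 Mc P1p P2p PAP r1 r2.
have C1p := orth_projectorC P1p; have C2p := orth_projectorC P2p.
have [[P1t P11] [P2t P22]] := (P1p, P2p).
have [[C1t C11] [C2t C22]] := (C1p, C2p).
pose N1 := P1 *m M; pose N2 := (1%:M - P1) *m M *m P2.
pose N3 := (1%:M - P1) *m M *m (1%:M - P2).
have -> : M = N3 + (N1 + N2).
  by rewrite /N3 mulmxBr mulmx1 /N1 /N2 addrA addrAC subrK -mulmxDl subrK mul1mx.
rewrite mxdotDl lerD//.
  have -> : mxdot N3 (B - A) = mxdot M ((1%:M - P1) *m B *m (1%:M - P2)).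
    rewrite mxdot_mulr mxdot_mull C1t C2t mulmxA (mulmxBr _ B) mulmxBl.
    suff -> : (1%:M - P1) *m A *m (1%:M - P2) = 0 by rewrite subr0.
    by rewrite -PAP !mulmxA mulmxBl mul1mx P11 subrr !mul0mx.
  exact: trace_duality.
apply: mxdot_le; rewrite ?mulr_ge0 ?sqrtr_ge0//; last first.
  by rewrite sqr_sqrtr ?mxdot_ge0.
rewrite !exprMn !sqr_sqrtr//.
have N12 : mxdot N1 N2 = 0.
  rewrite mxdot_mull P1t !mulmxA mulmxBr mulmx1 P11 subrr !mul0mx.
  by rewrite /mxdot mulmx0 mxtrace0.
rewrite mxdotDl !mxdotDr N12 (mxdotC N2) N12 addr0 add0r.
have -> : 2 * c ^+ 2 * r = c ^+ 2 * r + c ^+ 2 * r by ring.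
apply: lerD.
  (* [N1] is transposed so that the operator bound acts on [P1]. *)
  rewrite -mxdot_tr trmx_mul (le_trans (opbound_tr Mc _))// P1t.
  by rewrite ler_wpM2l ?sqr_ge0.
rewrite /N2 -mulmxA (le_trans (mxdot_projector_le _ C1p))// (le_trans (Mc _ _))//.
by rewrite ler_wpM2l ?sqr_ge0.
Qed.

(** The numbers [qA], [qB], [qD] stand for the squared semi-norms of [A - A0], [B - A0], [B - A]. In
    the constant, 1 comes from the subgradient and [Num.sqrt 2] from the noise. *)
Lemma low_rank_oracle m n (M A B : 'M[R]_(m, n)) P1 P2 (r lambda mu qA qB qD : R) :
  0 < mu -> 2 * operator_norm M <= lambda -> 0 <= r ->
  orth_projector P1 -> orth_projector P2 -> P1 *m A *m P2 = A ->
  mxdot P1 P1 <= r -> mxdot P2 P2 <= r ->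
  mu ^- 2 * frobenius_norm (B - A) ^+ 2 <= qD ->
  qB + qD <= qA + 2 * mxdot M (B - A)
             + lambda * (nuclear_norm A - nuclear_norm B) ->
  qB + (lambda - 2 * operator_norm M)
       * nuclear_norm ((1%:M - P1) *m B *m (1%:M - P2))
  <= qA + ((1 + Num.sqrt 2) / 2) ^+ 2 * mu ^+ 2 * lambda ^+ 2 * r.
Proof.
move=> mu0 Mlambda r0 P1p P2p PAP r1 r2 Dmu first_order.
have c0 := operator_norm_ge0 M.
have lambda0 : 0 <= lambda by rewrite (le_trans _ Mlambda)// mulr_ge0.
have [U Ur sub] := nuclear_norm_subgradient B P1p P2p PAP.
have := mxdot_noise_le B c0 r0 (@opbound_operator_norm _ _ _ M) P1p P2p PAP r1 r2.
have : - mxdot U (B - A) <= Num.sqrt r * frobenius_norm (B - A).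
  rewrite -mxdotNl mxdot_le ?sqrtr_ge0//; last by rewrite sqr_sqrtr ?mxdot_ge0.
  by rewrite mxdotNl mxdotNr opprK sqr_sqrtr// (le_trans Ur).
move: sub first_order Dmu.
set K := nuclear_norm (_ *m B *m _); set f := frobenius_norm _.
set c := operator_norm M in c0 Mlambda *; set s := Num.sqrt r; set q := Num.sqrt 2.
move=> sub first_order Dmu Uf Mf.
have s2 : s ^+ 2 = r by rewrite sqr_sqrtr.
have [s0 f0 q0] : [/\ 0 <= s, 0 <= f & 0 <= q] by split; exact: sqrtr_ge0.
have h1 : lambda * (nuclear_norm A - nuclear_norm B) <= lambda * (s * f - K).
  by rewrite ler_wpM2l//; lra.
have h2 : 2 * (q * c * s * f) <= q * lambda * s * f.
  have -> : 2 * (q * c * s * f) = (2 * c) * (q * s * f) by ring.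
  have -> : q * lambda * s * f = lambda * (q * s * f) by ring.
  by rewrite ler_wpM2r ?mulr_ge0.
(* AM-GM in the form 2 x y <= x^2 + y^2 *)
have h3 : (1 + q) * lambda * s * f
    <= ((1 + q) / 2) ^+ 2 * mu ^+ 2 * lambda ^+ 2 * r + mu ^- 2 * f ^+ 2.
  rewrite -subr_ge0 -s2.
  have -> : ((1 + q) / 2) ^+ 2 * mu ^+ 2 * lambda ^+ 2 * s ^+ 2 + mu ^- 2 * f ^+ 2
      - (1 + q) * lambda * s * f = ((1 + q) / 2 * mu * lambda * s - f / mu) ^+ 2.
    by field; rewrite gt_eqF.
  exact: sqr_ge0.
(* The term [mu ^- 2 * f ^+ 2] from [h3] is absorbed by [qD], and the [K] terms combine to
   [- (lambda - 2 * c) * K]. *)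
nra.
Qed.

End OracleInequality.

(** * Moments of the design *)

Section PullOut.
Context d (T : measurableType d) (R : realType) (P : probability T R).
Context d' (T' : measurableType d') (X : T -> T') (D : T -> R).
Hypothesis mX : measurable_fun [set: T] X.
Hypothesis iD : P.-integrable setT (EFin \o D).
Hypothesis D0 : forall B : set T', measurable B ->
  (\int[P]_(w in X @^-1` B) (D w)%:E = 0)%E.

Import HBNNSimple.

(** Here [D] plays a residual with zero conditional mean given [X]. A simple function of [X] is
    constant on finitely many preimages under [X], and [D] integrates to 0 on each. *)
Lemma integral_mul_nnsfun_eq0 (h : {nnsfun T' >-> R}) :
  (\int[P]_w (D w * h (X w))%:E = 0)%E.
Proof.
have mB y : measurable (h @^-1` [set y]) by exact: measurable_sfunP.
have mXB y : measurable (X @^-1` (h @^-1` [set y])).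
  by rewrite -[X @^-1` _]setTI; exact: mX.
pose r := finmap.enum_fset (fset_set (range h)).
have -> : (\int[P]_w (D w * h (X w))%:E =
    \int[P]_w (\sum_(y <- r) y%:E * ((EFin \o D) \_ (X @^-1` (h @^-1` [set y]))) w))%E.
  apply: eq_integral => w _; rewrite fimfunE fsbig_finite//= mulr_sumr -sumEFin.
  apply: eq_bigr => y _; rewrite patchE -[(_ \in _ @^-1` _)]/(X w \in h @^-1` [set y]).
  rewrite indicE; case: ifP => _; first by rewrite mulr1 mulrC.
  by rewrite !mulr0 mule0.
have iDy y : P.-integrable setT ((EFin \o D) \_ (X @^-1` (h @^-1` [set y]))).
  by apply/integrable_restrict => //; rewrite setTI; exact: integrableS iD.
rewrite integral_sum// => [|y]; last exact: integrableZl.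
rewrite big1// => y _; rewrite integralZl// -integral_mkcond D0 ?mule0//.
Qed.

(** Simple functions increase to [g], so [D * g] composed with [X] dominates the approximating
    products and the limit passes under the integral. *)
Let pull_out_ge0 (g : T' -> R) : measurable_fun setT g -> (forall x, 0 <= g x) ->
  P.-integrable setT (fun w => (D w * g (X w))%:E) ->
  (\int[P]_w (D w * g (X w))%:E = 0)%E.
Proof.
move=> mg g0 iDg.
have mg' : measurable_fun [set: T'] (EFin \o g) by exact/measurable_EFinP.
pose h := nnsfun_approx measurableT mg'.
have mD : measurable_fun setT D by apply/measurable_EFinP; exact: measurable_int iD.
have [|||||_ _] := @dominated_convergence _ _ _ P setT measurableT
  (fun k w => (D w * h k (X w))%:E) (fun w => (D w * g (X w))%:E)
  (fun w => `|(D w * g (X w))%:E|%E).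
- move=> k; apply/measurable_EFinP; apply: measurable_funM => //.
  exact: measurableT_comp.
- exact: measurable_int iDg.
- apply: aeW => w _.
  under eq_fun do rewrite EFinM.
  rewrite EFinM; apply: cvgeZl => //.
  by apply: (cvg_nnsfun_approx measurableT mg') => // x _; rewrite lee_fin.
- exact: integrable_abse.
- apply: aeW => w k _; rewrite lee_fin !normrM ler_wpM2l//.
  rewrite !ger0_norm// -lee_fin.
  by rewrite /h nnsfun_approxE; apply: le_approx => // x _; rewrite lee_fin.
rewrite (_ : [sequence _]_n = cst 0%E) => [/cvg_lim <-//|]; last first.
  by apply/funext => k /=; exact: integral_mul_nnsfun_eq0.
by rewrite lim_cst.
Qed.

Lemma integral_pull_out (g : T' -> R) : measurable_fun setT g ->
  P.-integrable setT (fun w => (D w * g (X w))%:E) ->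
  (\int[P]_w (D w * g (X w))%:E = 0)%E.
Proof.
move=> mg iDg.
have mD : measurable_fun setT D by apply/measurable_EFinP; exact: measurable_int iD.
pose gp x := Num.max (g x) 0; pose gn x := Num.max (- g x) 0.
have mgp : measurable_fun [set: T'] gp by exact: measurable_funrpos.
have mgn : measurable_fun [set: T'] gn by exact: measurable_funrneg.
have gpnE x : g x = gp x - gn x.
  by rewrite /gp /gn; case: (leP (g x) 0) => ?; case: (leP (- g x) 0) => ?; lra.
have i (f : T' -> R) : measurable_fun [set: T'] f -> (forall x, `|f x| <= `|g x|) ->
    P.-integrable setT (fun w => (D w * f (X w))%:E).
  move=> mf fg; apply: le_integrable iDg => //.
    by apply/measurable_EFinP; apply: measurable_funM => //; exact: measurableT_comp.
  by move=> w _; rewrite lee_fin !normrM ler_wpM2l.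
have igp : P.-integrable setT (fun w => (D w * gp (X w))%:E).
  apply: i => // x; rewrite /gp; case: (leP (g x) 0) => ?; rewrite ?normr0//.
have ign : P.-integrable setT (fun w => (D w * gn (X w))%:E).
  by apply: i => // x; rewrite /gn; case: (leP (- g x) 0) => ?; rewrite ?normr0 ?normrN.
under eq_integral do rewrite gpnE mulrBr EFinB.
rewrite integralB// !pull_out_ge0 ?sube0//.
- by move=> x; rewrite le_max lexx orbT.
- by move=> x; rewrite le_max lexx orbT.
Qed.

End PullOut.

Lemma Rintegral_sum d (T : measurableType d) (R : realType)
    (mu : {measure set T -> \bar R}) (I : finType) (f : I -> T -> R) :
  (forall i, mu.-integrable setT (EFin \o f i)) ->
  \int[mu]_w (\sum_i f i w) = \sum_i \int[mu]_w f i w.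
Proof.
move=> fi; rewrite /Rintegral.
under eq_integral do rewrite -sumEFin.
rewrite (integral_sum measurableT fi) -sum_fine// => i _.
exact: integrable_fin_num.
Qed.

Lemma measurable_borel_mx_entry (R : realType) m n (a : 'I_m) (b : 'I_n) :
  measurable_fun [set: borel_mx R m n] (fun x : borel_mx R m n => (x : 'M[R]_(m, n)) a b).
Proof.
apply: (measurability _ (RGenOpens.measurableE R)) => _ [_ [x [y ->]] <-].
rewrite setTI; apply: sub_sigma_algebra.
by apply: open_comp => [? _|]; [exact: coord_continuous|exact: interval_open].
Qed.

(** * Second moments and the law of iterated expectations *)

Section Model.
Context {d : measure_display} {T : measurableType d} {R : realType}.
Context {P : probability T R} {m1 m2 n : nat}.
Variables (X : 'I_n -> {RV P >-> borel_mx R m1 m2}) (Y : 'I_n -> {RV P >-> R}).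
Variable A0 : 'M[R]_(m1, m2).
Hypothesis model : trace_regression X Y A0.

Let integrable_sq i A := trace_regression_sq_integrable model i A.

(** Polarization: the product is half the square for [A + B] minus the squares for [A] and [B]. *)
Lemma integrable_mxdot_mul i (A B : 'M[R]_(m1, m2)) :
  P.-integrable setT (fun w => (mxdot A (X i w) * mxdot B (X i w))%:E).
Proof.
have h := integrableZl measurableT 2^-1 (integrableB measurableT
  (integrableB measurableT (integrable_sq i (A + B)) (integrable_sq i A))
  (integrable_sq i B)).
apply: eq_integrable h => // w _ /=.
by rewrite -!EFinB -EFinM mxdotDl; congr EFin; field.
Qed.

(** The symmetric bilinear form whose diagonal is the squared semi-norm. *)
Definition second_moment (A B : 'M[R]_(m1, m2)) : R :=
  n%:R^-1 * \sum_i \int[P]_w (mxdot A (X i w) * mxdot B (X i w)).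

Lemma sqnorm_L2PiE A : sqnorm_L2Pi X A = second_moment A A.
Proof. by rewrite /sqnorm_L2Pi expectation.unlock. Qed.

Lemma sqnorm_L2Pi_comb (a b : R) (A B : 'M[R]_(m1, m2)) :
  sqnorm_L2Pi X (a *: A + b *: B) = a ^+ 2 * sqnorm_L2Pi X A
    + 2 * a * b * second_moment A B + b ^+ 2 * sqnorm_L2Pi X B.
Proof.
rewrite !sqnorm_L2PiE /second_moment !(mulrCA _ n%:R^-1) -!mulrDr; congr (_ * _).
rewrite !mulr_sumr -!big_split; apply: eq_bigr => i _ /=.
have iM := integrable_mxdot_mul i.
have iZ c C D := integrableZl measurableT c (iM C D).
do 3![rewrite -RintegralZl; [|by []|exact: iM]].
rewrite -RintegralD; [|by []|exact: iZ|exact: iZ].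
rewrite -RintegralD; [|by []|exact: integrableD (iZ _ _ _) (iZ _ _ _)|exact: iZ].
by apply: eq_Rintegral => w _; rewrite !mxdotDl !mxdotZl; ring.
Qed.

(** An entry is a measurable function of the design, so it can be pulled out against the residual
    [Y i w - mxdot (X i w) A0]. *)
Lemma integral_response_entry i a b :
  (\int[P]_w (Y i w * (X i w : 'M[R]_(m1, m2)) a b)
   = \int[P]_w (mxdot (X i w) A0 * (X i w : 'M[R]_(m1, m2)) a b))%R.
Proof.
have [iY iZ _ condYZ] := trace_regression_cond model i.
pose entry (x : borel_mx R m1 m2) := (x : 'M[R]_(m1, m2)) a b.
have iYX : P.-integrable setT (fun w => (Y i w * entry (X i w))%:E).
  apply: eq_integrable (trace_regression_YX_integrable model i a b) => // w _.
  by rewrite mxE.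
have iZX : P.-integrable setT (fun w => (mxdot (X i w) A0 * entry (X i w))%:E).
  apply: eq_integrable (integrable_mxdot_mul i A0 (delta_mx a b)) => // w _.
  by rewrite mxdot_delta mxdotC.
apply/eqP; rewrite -subr_eq0 -RintegralB//; apply/eqP.
under eq_Rintegral do rewrite -mulrBl.
rewrite /Rintegral.
rewrite (@integral_pull_out _ _ _ _ _ _ (X i) (fun w => Y i w - mxdot (X i w) A0) _ _ _ entry)//.
- exact: (integrableB measurableT iY iZ).
- move=> B mB.
  have mXB : measurable (X i @^-1` B) by exact: measurable_sfunP.
  under eq_integral do rewrite EFinB.
  rewrite integralB//; try by apply: integrableS measurableT mXB _ _.
  rewrite condYZ ?subee//; last by exists B => //; rewrite setTI.
  by apply: integrable_fin_num => //; apply: integrableS measurableT mXB _ _.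
- exact: measurable_borel_mx_entry.
- have := integrableB measurableT iYX iZX.
  by apply: eq_integrable => // w _; rewrite -EFinB -mulrBl.
Qed.

Lemma mxdot_mx_expectation i (A : 'M[R]_(m1, m2)) :
  mxdot (mx_expectation P (fun w => Y i w *: (X i w : 'M[R]_(m1, m2)))) A
  = \int[P]_w (mxdot A (X i w) * mxdot A0 (X i w)).
Proof.
rewrite mxdotE pair_bigA /=.
(* Expanding [A] in matrix units reduces the claim to single entries. *)
transitivity (\int[P]_w (\sum_(p : 'I_m1 * 'I_m2) mxdot A0 (X i w) *
    mxdot (A p.1 p.2 *: delta_mx p.1 p.2) (X i w))); last first.
  apply: eq_Rintegral => w _; rewrite -mulr_sumr -mxdot_suml mulrC.
  by rewrite [in RHS](matrix_sum_delta A) pair_bigA.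
rewrite Rintegral_sum; last by move=> p; exact: integrable_mxdot_mul.
apply: eq_bigr => -[a b] _ /=.
transitivity (A a b * \int[P]_w (Y i w * (X i w : 'M[R]_(m1, m2)) a b)).
  rewrite mxE expectation.unlock mulrC; congr (_ * _).
  by apply: eq_Rintegral => w _; rewrite mxE.
rewrite integral_response_entry -RintegralZl//; last first.
  have := integrable_mxdot_mul i A0 (delta_mx a b).
  by apply: eq_integrable => // w _; rewrite mxdot_delta mxdotC.
by apply: eq_Rintegral => w _; rewrite mxdotZl mxdot_delta (mxdotC A0); ring.
Qed.

End Model.

(** * The objective as a penalized excess risk, and its minimizers *)

Section Excess.
Context {d : measure_display} {T : measurableType d} {R : realType}.
Context {P : probability T R} {m1 m2 n : nat}.
Variables (X : 'I_n -> {RV P >-> borel_mx R m1 m2}) (Y : 'I_n -> {RV P >-> R}).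
Variable A0 : 'M[R]_(m1, m2).
Hypothesis model : trace_regression X Y A0.

Lemma mxdot_noise_mx w A :
  mxdot (noise_mx X Y w) A
  = n%:R^-1 * \sum_i mxdot (Y i w *: (X i w : 'M[R]_(m1, m2))) A
    - second_moment X A A0.
Proof.
rewrite mxdotZl mxdot_suml /second_moment -mulrBr -sumrB; congr (_ * _).
by apply: eq_bigr => i _; rewrite mxdotBl (mxdot_mx_expectation model).
Qed.

(** Completing the square: the cross term of [A] and [A0] in the semi-norm cancels the mean
    subtracted in the noise. *)
Lemma objectiveE lambda w A : objective X Y lambda w A =
  sqnorm_L2Pi X (A - A0) - sqnorm_L2Pi X A0 - 2 * mxdot (noise_mx X Y w) A
  + lambda * nuclear_norm A.
Proof.
have -> : A - A0 = 1 *: A + (-1) *: A0 by rewrite scale1r scaleN1r.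
rewrite (sqnorm_L2Pi_comb model) mxdot_noise_mx /objective mxdotZl mxdot_suml.
by ring.
Qed.

Lemma sqnorm_L2Pi_ge0 A : 0 <= sqnorm_L2Pi X A.
Proof.
rewrite sqnorm_L2PiE mulr_ge0 ?invr_ge0// sumr_ge0// => i _.
by apply: Rintegral_ge0 => w _; rewrite -expr2 sqr_ge0.
Qed.

(** The exact convexity defect of a quadratic form; it supplies the extra term in [B - A] of the
    first-order condition. *)
Lemma sqnorm_L2Pi_conv t A B :
  sqnorm_L2Pi X (t *: A + (1 - t) *: B) = t * sqnorm_L2Pi X A
    + (1 - t) * sqnorm_L2Pi X B - t * (1 - t) * sqnorm_L2Pi X (B - A).
Proof.
have -> : B - A = (-1) *: A + 1 *: B by rewrite scale1r scaleN1r addrC.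
by rewrite !(sqnorm_L2Pi_comb model); ring.
Qed.

(** In the comparison of objectives, the noise at [B] is absorbed by the penalty of [B], and the
    noise at [A] at most doubles the penalty of [A]. *)
Lemma slow_rate_oracle (AA : set 'M[R]_(m1, m2)) lambda w B A :
  is_minimizer (objective X Y lambda w) AA B -> AA A ->
  2 * operator_norm (noise_mx X Y w) <= lambda ->
  sqnorm_L2Pi X (B - A0) <= sqnorm_L2Pi X (A - A0) + 2 * lambda * nuclear_norm A.
Proof.
move=> [_ /(_ A)] + AA_A => /(_ AA_A); rewrite !objectiveE.
set M := noise_mx X Y w; set c := operator_norm M => minB cl.
have Mc : opbound c M by exact: opbound_operator_norm.
have NMc : opbound c (- M).
  by move=> p Z; rewrite mulNmx mxdotNl mxdotNr opprK; exact: Mc.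
have c0 : 0 <= c by exact: operator_norm_ge0.
have := trace_duality B c0 Mc; have := trace_duality A c0 NMc; rewrite mxdotNl.
have := nuclear_norm_ge0 A; have := nuclear_norm_ge0 B.
nra.
Qed.

(* Comparing B with the points t A + (1 - t) B and letting t tend to 0 replaces the
   subdifferential calculus. *)
Lemma first_order_condition (AA : set 'M[R]_(m1, m2)) lambda w B A :
  0 <= lambda -> convex_set (AA : set (convex_lmodType 'M[R]_(m1, m2))) ->
  is_minimizer (objective X Y lambda w) AA B -> AA A ->
  sqnorm_L2Pi X (B - A0) + sqnorm_L2Pi X (B - A) <=
    sqnorm_L2Pi X (A - A0) + 2 * mxdot (noise_mx X Y w) (B - A)
    + lambda * (nuclear_norm A - nuclear_norm B).
Proof.
move=> lambda0 cAA [AA_B minB] AA_A.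
set rhs := (X in _ <= X); set q := sqnorm_L2Pi X (B - A).
have step t : 0 < t <= 1 -> sqnorm_L2Pi X (B - A0) + (1 - t) * q <= rhs.
  move=> /andP[t0 t1].
  have t01 : 0 <= t <= 1 by rewrite ltW.
  pose C := t *: A + (1 - t) *: B.
  have AA_C : AA C.
    have := cAA A B (Itv01 (ltW t0) t1).
    rewrite !inE; exact.
  have := minB C AA_C; rewrite !objectiveE.
  have -> : C - A0 = t *: (A - A0) + (1 - t) *: (B - A0).
    rewrite /C !scalerBr addrACA -opprD -scalerDl.
    by rewrite (addrC t) subrK scale1r.
  rewrite sqnorm_L2Pi_conv; have -> : B - A0 - (A - A0) = B - A.
    by rewrite opprB addrA subrK.
  have := nuclear_norm_conv A B t01; rewrite -/C mxdotDr !mxdotZr -/q.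
  move=> nC; move/(ler_wpM2l lambda0) : nC => nC minBC.
  (* Once the values at [B] cancel, every term carries the factor [t], which is divided out. *)
  rewrite -(ler_pM2l t0) /rhs mxdotBr; lra.
have q0 : 0 <= q by exact: sqnorm_L2Pi_ge0.
rewrite leNgt; apply/negP => lt_rhs.
(* If the excess [e] were positive, the step [e / (q + e + 1)] would lie in the unit interval and
   cost less than [e], contradicting [step]. *)
pose e := sqnorm_L2Pi X (B - A0) + q - rhs.
have e0 : 0 < e by rewrite subr_gt0.
have q1 : 0 < q + e + 1 by lra.
have := step (e / (q + e + 1)); rewrite divr_gt0// ler_pdivrMr// => /(_ _)/wrap[].
  by apply/andP; split => //; lra.
rewrite leNgt => /negP; apply.
have : e / (q + e + 1) * q < e.
  by rewrite -mulrA gtr_pMr// mulrC ltr_pdivrMr//; lra.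
rewrite /e; lra.
Qed.

End Excess.

Theorem theorem1 (d : measure_display) (T : measurableType d) (R : realType)
    (P : probability T R) (m1 m2 n : nat) (n_gt0 : (0 < n)%N)
    (X : 'I_n -> {RV P >-> borel_mx R m1 m2}) (Y : 'I_n -> {RV P >-> R})
    (A0 : 'M[R]_(m1, m2)) (model : trace_regression X Y A0)
    (AA : set 'M[R]_(m1, m2)) (lambda : R) (lambda_gt0 : 0 < lambda)
    (w : T) (Ahat : 'M[R]_(m1, m2))
    (Ahat_min : is_minimizer (objective X Y lambda w) AA Ahat)
    (lambda_ge : 2 * operator_norm (noise_mx X Y w) <= lambda) :
  sqnorm_L2Pi X (Ahat - A0) <=
    inf [set sqnorm_L2Pi X (A - A0) + 2 * lambda * nuclear_norm A | A in AA]
  /\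
  (convex_set (AA : set (convex_lmodType 'M[R]_(m1, m2))) ->
   forall mu : R, 0 < mu ->
   (forall A, [set A1 - A2 | A1 in AA & A2 in AA] A ->
      mu ^- 2 * frobenius_norm A ^+ 2 <= sqnorm_L2Pi X A) ->
   sqnorm_L2Pi X (Ahat - A0) <=
     inf [set sqnorm_L2Pi X (A - A0)
              + ((1 + Num.sqrt 2) / 2) ^+ 2 * mu ^+ 2 * lambda ^+ 2
                * (\rank A)%:R | A in AA]
   /\
   (forall (A : 'M[R]_(m1, m2)) (S1 : 'M[R]_m1) (S2 : 'M[R]_m2),
      AA A -> is_support A S1 S2 ->
      sqnorm_L2Pi X (Ahat - A0)
      + (lambda - 2 * operator_norm (noise_mx X Y w))
        * nuclear_norm (orth_proj (orth_compl S1) *m Ahat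
                        *m orth_proj (orth_compl S2))
      <= sqnorm_L2Pi X (A - A0)
         + ((1 + Num.sqrt 2) / 2) ^+ 2 * mu ^+ 2 * lambda ^+ 2
           * (\rank A)%:R)).
Proof.
have [AA_Ahat _] := Ahat_min.
split.
  (* A lower bound is below [inf] only for a nonempty set; [Ahat] supplies a point. *)
  apply: lb_le_inf; first by eexists; exists Ahat.
  by move=> _ [A AA_A <-]; exact: (slow_rate_oracle model Ahat_min).
move=> cAA mu mu_gt0 strong.
(* Stated for any subspaces of the right rank whose projectors fix [A], so that it serves both
   remaining claims. *)
have oracle A (S1 : 'M[R]_m1) (S2 : 'M[R]_m2) : AA A ->
    orth_proj S1 *m A *m orth_proj S2 = A ->
    \rank S1 = \rank A -> \rank S2 = \rank A ->
    sqnorm_L2Pi X (Ahat - A0) + (lambda - 2 * operator_norm (noise_mx X Y w))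
      * nuclear_norm (orth_proj (orth_compl S1) *m Ahat *m orth_proj (orth_compl S2))
    <= sqnorm_L2Pi X (A - A0)
       + ((1 + Num.sqrt 2) / 2) ^+ 2 * mu ^+ 2 * lambda ^+ 2 * (\rank A)%:R.
  move=> AA_A PAP rS1 rS2; rewrite !orth_proj_orth_compl.
  apply: (@low_rank_oracle _ _ _ _ A Ahat _ _ _ _ _ _ _ (sqnorm_L2Pi X (Ahat - A))) => //.
  - exact: orth_projP.
  - exact: orth_projP.
  - by rewrite mxdot_orth_proj rS1.
  - by rewrite mxdot_orth_proj rS2.
  - by apply: strong; exists Ahat => //; exists A.
  - exact: (first_order_condition model (ltW lambda_gt0) cAA Ahat_min).
split.
  apply: lb_le_inf; first by eexists; exists Ahat.
  move=> _ [A AA_A <-].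
  (* The column and row spaces of [A] are taken directly as subspaces, and the nonnegative nuclear
     norm term is dropped. *)
  apply: le_trans (oracle A <<A^T>>%MS <<A>>%MS AA_A _ _ _); last 3 first.
  - have [P1t _] := orth_projP <<A^T>>%MS.
    rewrite -mulmxA orth_proj_id ?genmxE//.
    by apply: trmx_inj; rewrite trmx_mul P1t orth_proj_id ?genmxE.
  - by rewrite mxrank_gen mxrank_tr.
  - by rewrite mxrank_gen.
  by rewrite lerDl mulr_ge0 ?nuclear_norm_ge0// subr_ge0.
move=> A S1 S2 AA_A [U [s [V [[UU VV _ AE] S1U S2V]]]].
(* Orthonormal columns are independent, so each support space has dimension the rank of [A]. *)
have rankU k p (W : 'M[R]_(p, k)) (S : 'M[R]_p) : W^T *m W = 1%:M ->
    (S :=: W^T)%MS -> \rank S = k.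
  move=> WW ->; apply/eqP; rewrite eqn_leq rank_leq_row.
  by rewrite -[X in (X <= _)%N](mxrank1 R) -WW mxrankM_maxl.
apply: oracle => //; [|exact: rankU UU S1U|exact: rankU VV S2V].
have [P1t _] := orth_projP S1.
have UP : orth_proj S1 *m U = U.
  by apply: trmx_inj; rewrite trmx_mul P1t orth_proj_id// S1U.
have VP : V^T *m orth_proj S2 = V^T by rewrite orth_proj_id// S2V.
by rewrite [in LHS]AE !(mulmxA (orth_proj S1)) UP -(mulmxA _ V^T) VP -AE.
Qed.
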